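(* There exists a unique function $\widetilde V:\Sigma\to\mathbb R$ such that $$\widetilde V(x)=\lim_{m\to\infty}\frac1m\sum_{k=0}^{m-1}(\mathcal R^kV)(x)\qquad (x\in\Sigma)$$ for every continuous $V:\Sigma\to\mathbb R$ satisfying $V(x)=\frac1n+o(\frac1n)$ if $d(x,\mathbb K)=2^{-n}$. Moreover, $\widetilde V$ is $\mathcal R$-invariant ($\mathcal R\widetilde V=\widetilde V$), continuous, and positive except on $\mathbb K$: $\frac1{2n}\le\widetilde V(x)\le\frac1{n-1}$ if $d(x,\mathbb K)=2^{-n}$.
   Context: $\Sigma=\{0,1\}^{\mathbb N}$ is the one-sided full shift (sequences $x=x_0x_1x_2\dots$) with shift $\sigma$ and metric $d(x,y)=2^{-n}$, where $n$ is the number of initial digits on which $x$ and $y$ agree ($n=\min\{i\ge0:x_i\ne y_i\}$), $d(x,x)=0$; $d(x,\mathbb K)=\inf_{y\in\mathbb K}d(x,y)$. $H$ is the Thue-Morse substitution $0\mapsto 01$, $1\mapsto 10$, acting on sequences by concatenation; $\rho_0,\rho_1\in\Sigma$ are its two fixed points, beginning with $0$ and $1$ respectively. $\mathbb K=\overline{\{\sigma^n(\rho_0):n\ge0\}}$ is the Thue-Morse subshift. The renormalization operator is $(\mathcal R V)(x)=V(\sigma(H(x)))+V(H(x))$. The condition $V(x)=\frac1n+o(\frac1n)$ if $d(x,\mathbb K)=2^{-n}$ means $\sup\{n\,|V(x)-\frac1n| : d(x,\mathbb K)=2^{-n}\}\to0$ as $n\to\infty$. *)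

(* Defs.v *)
From HB Require Import structures.
From mathcomp Require Import all_boot all_order all_algebra.
From mathcomp Require Import all_classical all_reals all_analysis.
From mathcomp Require Import zify.

Set Implicit Arguments.
Unset Strict Implicit.
Unset Printing Implicit Defensive.

Import Order.TTheory GRing.Theory Num.Theory.
Import numFieldNormedType.Exports.

Local Open Scope classical_set_scope.
Local Open Scope ring_scope.

(* The digits 0 and 1 are [false] and [true].  The parameter [R] does not occur
   in the carrier: it only records the field in which distances are measured,
   so that the metric below is a canonical structure. *)
Definition full_shift (R : realType) : Type := nat -> bool.

HB.instance Definition _ (R : realType) := gen_eqMixin (full_shift R).
HB.instance Definition _ (R : realType) := gen_choiceMixin (full_shift R).

Section Metric.
Context {R : realType}.
Implicit Types x y z : full_shift R.

Definition shift_dist x y : R :=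
  match pselect (exists i, x i != y i) with
  | left xy => 2 ^- ex_minn xy
  | right _ => 0
  end.

Lemma shift_distxx x : shift_dist x x = 0.
Proof. by rewrite /shift_dist; case: pselect => // xx; exfalso; case: xx => i; rewrite eqxx. Qed.

Lemma shift_dist_eq0 x y : shift_dist x y = 0 -> x = y.
Proof.
rewrite /shift_dist; case: pselect => [xy /eqP|nxy _].
  by rewrite invr_eq0 expf_eq0 pnatr_eq0 andbF.
by apply/funext => i; apply/eqP/negPn/negP => xyi; apply: nxy; exists i.
Qed.

Lemma shift_dist_ge0 x y : 0 <= shift_dist x y.
Proof. by rewrite /shift_dist; case: pselect => // xy; rewrite invr_ge0 exprn_ge0. Qed.

Lemma shift_dist_le x y n :
  (forall i, (i < n)%N -> x i = y i) <-> shift_dist x y <= 2 ^- n.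
Proof.
rewrite /shift_dist; case: pselect => [xy|nxy].
  rewrite lef_pV2 ?posrE ?exprn_gt0// ler_eXn2l ?ltr1n//.
  case: ex_minnP => m xym minm; split=> [agr|nm i lin].
    by rewrite leqNgt; apply/negP => /agr/eqP; rewrite (negPf xym).
  by apply/eqP/negPn/negP => /minm; rewrite leqNgt (leq_trans lin nm).
split=> [_|_ i _]; first by rewrite invr_ge0 exprn_ge0.
by apply/eqP/negPn/negP => xyi; apply: nxy; exists i.
Qed.

Lemma shift_dist_sym x y : shift_dist x y = shift_dist y x.
Proof.
suff le u v : shift_dist u v <= shift_dist v u.
  by apply/eqP; rewrite eq_le !le.
rewrite [leRHS]/shift_dist; case: pselect => [vu|nvu].
  apply/shift_dist_le => i; case: ex_minnP => m _ minm lim.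
  apply/eqP/negPn/negP => uv.
  by have := minm i; rewrite eq_sym => /(_ uv); rewrite leqNgt lim.
suff -> : u = v by rewrite shift_distxx.
by apply/funext => i; apply/eqP/negPn/negP => uv; apply: nvu; exists i; rewrite eq_sym.
Qed.

Lemma shift_dist_ultra y x z :
  shift_dist x z <= Num.max (shift_dist x y) (shift_dist y z).
Proof.
rewrite {1}/shift_dist; case: pselect => [xz|_]; last first.
  by rewrite le_max shift_dist_ge0.
rewrite leNgt; apply/negP; rewrite gt_max => /andP[].
case: ex_minnP => m xzm minm xy yz.
have pw : (2 ^- m = 2 * 2 ^- m.+1 :> R).
  by rewrite exprS invfM mulVKf.
have half u v : shift_dist u v < 2 ^- m -> shift_dist u v <= 2 ^- m.+1.
  rewrite /shift_dist; case: pselect => [uv|_ _]; last by rewrite invr_ge0 exprn_ge0.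
  by rewrite ltf_pV2 ?lef_pV2 ?posrE ?exprn_gt0// ltr_eXn2l ?ler_eXn2l ?ltr1n.
move: xzm; rewrite (proj2 (shift_dist_le _ _ _) (half _ _ xy))//.
by rewrite (proj2 (shift_dist_le _ _ _) (half _ _ yz))// eqxx.
Qed.

Lemma shift_dist_triangle y x z :
  shift_dist x z <= shift_dist x y + shift_dist y z.
Proof.
apply: le_trans (shift_dist_ultra y x z) _.
by rewrite ge_max lerDl lerDr !shift_dist_ge0.
Qed.

End Metric.

HB.instance Definition _ (R : realType) := @isMetric.Build R (full_shift R)
  (@shift_dist R) (@shift_distxx R) (@shift_dist_eq0 R) (@shift_dist_sym R)
  (@shift_dist_triangle R).

Section ThueMorse.
Context {R : realType}.
Implicit Types (x y : full_shift R) (V W : full_shift R -> R).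

Definition shift x : full_shift R := fun n => x n.+1.

Definition tm_letter (a : bool) : seq bool :=
  if a then [:: true; false] else [:: false; true].

(* Every letter has an image of length 2, so digit [n] of the concatenation
   lies in the image of [x (n %/ 2)], at position [n %% 2]; see [tm_subst_cat]. *)
Definition tm_subst x : full_shift R :=
  fun n => nth false (tm_letter (x n./2)) (odd n).

Lemma tm_subst_cat x n :
  mkseq (tm_subst x) n.*2 = flatten [seq tm_letter a | a <- mkseq x n].
Proof.
elim: n => // n IHn; rewrite doubleS !mkseqS map_rcons flatten_rcons -IHn.
rewrite -!cats1 -catA /tm_subst /= doubleK odd_double /= uphalf_double.
by case: (x n).
Qed.

(* The fixed point of the substitution with first digit [a]: the words
   [H^n(a)] extend one another, and digit [n] is settled after [n] steps. *)
Definition tm_fix (a : bool) : full_shift R :=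
  fun n => iter n tm_subst (fun=> a) n.

Lemma tm_iter_stable (a : bool) n m : (n <= m)%N ->
  iter m tm_subst (fun=> a) n = tm_fix a n.
Proof.
have step k : forall i, (i <= k)%N ->
    iter k.+1 tm_subst (fun=> a) i = iter k tm_subst (fun=> a) i.
  elim: k => [|k IHk] i ik.
    by move: ik; rewrite leqn0 => /eqP ->; rewrite /= /tm_subst /=; case: a.
  rewrite iterS [in RHS]iterS {1}/tm_subst [in RHS]/tm_subst IHk//; lia.
move=> nm; rewrite -(subnK nm); elim: (m - n)%N => // k IHk.
by rewrite addSn step ?IHk// leq_addl.
Qed.

Lemma tm_fixP (a : bool) x : (tm_subst x = x /\ x 0%N = a) <-> x = tm_fix a.
Proof.
have fix_eq : tm_subst (tm_fix a) = tm_fix a.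
  apply/funext => n; rewrite -(@tm_iter_stable a n n.+1)// iterS /tm_subst.
  by rewrite (@tm_iter_stable a n./2 n)//; lia.
split=> [[xfix x0]|->]; last by rewrite fix_eq; split.
apply/funext => n; elim/ltn_ind: n => -[|n] IHn; first by rewrite x0.
by rewrite -xfix -fix_eq /tm_subst IHn//; lia.
Qed.

Definition tm_subshift : set (full_shift R) :=
  closure [set iter n shift (tm_fix false) | n in setT].

Definition dist_to (A : set (full_shift R)) x : R :=
  inf [set mdist x y | y in A].

Definition renorm V : full_shift R -> R :=
  fun x => V (shift (tm_subst x)) + V (tm_subst x).

(* The supremum is taken in the extended reals: it is [+oo] on an unbounded
   set and [-oo] on the empty one. *)
Definition one_over_n V : Prop :=
  ereal_sup [set (n%:R * `|V x - n%:R^-1|)%:E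
            | x in [set x | dist_to tm_subshift x = 2 ^- n]]
    @[n --> \oo] --> 0%E.

Definition is_cesaro_limit V W : Prop :=
  forall x, m%:R^-1 * (\sum_(0 <= k < m) iter k renorm V x) @[m --> \oo] --> W x.

End ThueMorse.

(* Main.v *)
Require Import Defs.
From mathcomp Require Import all_boot all_order all_algebra.
From mathcomp Require Import all_classical all_reals all_analysis.
From mathcomp Require Import zify ring lra.

(* Let n be the length of the longest prefix of x occurring in the Thue-Morse
   sequence, so that d(x, K) = 2^-n.  Words of length at least 5 determine the
   parity of their occurrences, so for n >= 3 the points H x and sigma (H x)
   have such prefixes of lengths exactly 2n and 2n - 1; for n = 2 the point x
   begins with a cube of a letter and both lengths are 4.  Hence the function U
   that is ln (n / (n - 1)) for n >= 3, 2 ln (4 / 3) for n = 2 and 0 on K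
   telescopes: R U = U.  If V = 1/n + o(1/n), then |V - U| <= e U at all points
   close enough to K; as R is positive and fixes U, this gives
   |R^k V - U| <= e U everywhere for large k.  So even the iterates R^k V
   converge to U.  Uniqueness follows by taking V = U, which satisfies the
   hypothesis because every n >= 2 is attained by some x. *)

Import Order.TTheory GRing.Theory Num.Theory.
Import numFieldNormedType.Exports.

Local Open Scope classical_set_scope.
Local Open Scope ring_scope.

(** * Combinatorics of the Thue-Morse sequence: cubes, alternating words, recognizability *)

Section Words.
Context {R : realType}.
Implicit Types x y : full_shift R.

Definition tm : full_shift R := tm_fix false.

Lemma tm_subst_double x n : tm_subst x n.*2 = x n.
Proof. by rewrite /tm_subst doubleK odd_double; case: (x n). Qed.

Lemma tm_subst_doubleS x n : tm_subst x n.*2.+1 = ~~ x n.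
Proof. by rewrite /tm_subst /= uphalf_double odd_double; case: (x n). Qed.

Lemma tm_subst_eq x i :
  tm_subst x i = if odd i then ~~ x i./2 else x i./2.
Proof.
rewrite -{1}(odd_double_half i); case: (odd i) => /=.
  by rewrite add1n tm_subst_doubleS.
by rewrite add0n tm_subst_double.
Qed.

Lemma tm_substK : tm_subst tm = tm.
Proof. by have [] := (tm_fixP false tm).2 erefl. Qed.

Lemma tm0 : tm 0%N = false.
Proof. by have [] := (tm_fixP false tm).2 erefl. Qed.

Lemma tm_double n : tm n.*2 = tm n.
Proof. by rewrite -{1}tm_substK tm_subst_double. Qed.

Lemma tm_doubleS n : tm n.*2.+1 = ~~ tm n.
Proof. by rewrite -{1}tm_substK tm_subst_doubleS. Qed.

(** Fourteen digits supply all explicit occurrences used below; the last four form the first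
    occurrence of 0101. *)
Lemma tm_prefix i : (i < 14)%N ->
  tm i = nth false [:: false; true; true; false; true; false; false; true;
                       true; false; false; true; false; true] i.
Proof.
elim/ltn_ind: i => -[_ _|i IHi i14]; first exact: tm0.
rewrite -tm_substK tm_subst_eq (IHi i.+1./2); [|lia|lia].
by move: i i14 {IHi}; do 14?[case=> //].
Qed.

(** Three consecutive positions contain a whole block of the substitution, whose two letters
    differ. *)
Lemma tm_cube_free n : ~ (tm n = tm n.+1 /\ tm n.+1 = tm n.+2).
Proof.
rewrite -(odd_double_half n); set m := n./2; case: (odd n) => /=.
  by rewrite add1n -doubleS !tm_doubleS !tm_double => -[_]; case: (tm m.+1).
by rewrite add0n -doubleS !tm_doubleS !tm_double => -[+ _]; case: (tm m).
Qed.

(** Consecutive blocks of an alternating word are images of equal letters. Five letters meet three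
    blocks, so desubstitution would give a cube. *)
Lemma tm_alternating p : ~ (forall i, (i < 4)%N -> tm (p + i)%N = ~~ tm (p + i.+1)%N).
Proof.
rewrite -(odd_double_half p); set m := p./2; case: (odd p) => /= alt.
  move: (alt 0%N isT) (alt 1%N isT) (alt 2%N isT) (alt 3%N isT).
  rewrite (_ : (_ + 0)%N = m.*2.+1); last lia.
  rewrite (_ : (_ + 1)%N = m.+1.*2); last lia.
  rewrite (_ : (_ + 2)%N = m.+1.*2.+1); last lia.
  rewrite (_ : (_ + 3)%N = m.+2.*2); last lia.
  rewrite !tm_doubleS !tm_double => a0 _ a2 _; apply: (@tm_cube_free m).
  by move: a0 a2; do 3!case: (tm _).
move: (alt 0%N isT) (alt 1%N isT) (alt 2%N isT) (alt 3%N isT).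
rewrite (_ : (_ + 0)%N = m.*2); last lia.
rewrite (_ : (_ + 1)%N = m.*2.+1); last lia.
rewrite (_ : (_ + 2)%N = m.+1.*2); last lia.
rewrite (_ : (_ + 3)%N = m.+1.*2.+1); last lia.
rewrite (_ : (_ + 4)%N = m.+2.*2); last lia.
rewrite !tm_doubleS !tm_double => _ a1 _ a3; apply: (@tm_cube_free m).
by move: a1 a3; do 3!case: (tm _).
Qed.

(* Blocks of the substitution have distinct letters, so a word of length 5
   occurring at positions of both parities would be alternating. *)
Lemma tm_recognizable p q :
  (forall i, (i < 5)%N -> tm (p + i)%N = tm (q + i)%N) -> odd p = odd q.
Proof.
have diff n : ~~ odd n -> tm n = ~~ tm n.+1.
  by move=> /negPf n2; rewrite -(odd_double_half n) n2 add0n tm_doubleS tm_double negbK.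
wlog: p q / ~~ odd p && odd q => [wlg pq|/andP[podd qodd] pq].
  case: (boolP (odd p)) (boolP (odd q)) => p2 [] q2 //.
    have /= := wlg q p; rewrite p2 (negPf q2) => <- //.
    by move=> i i5; rewrite pq.
  by have := wlg p q; rewrite q2 (negPf p2) => <-.
exfalso; apply: (@tm_alternating p) => i i4.
have ltS5 : (i.+1 < 5)%N by lia.
have lt5 : (i < 5)%N by lia.
case: (boolP (odd i)) => i2.
  by rewrite !pq// !addnS diff // oddD qodd i2.
by rewrite addnS diff// oddD (negPf podd).
Qed.

(** * Longest admissible prefixes and their growth under the substitution *)

Definition admissible x n := exists p, forall i, (i < n)%N -> x i = tm (p + i)%N.

Lemma admissible_le {x m n} : (m <= n)%N -> admissible x n -> admissible x m.
Proof. by move=> mn [p xp]; exists p => i im; apply: xp; apply: leq_trans mn. Qed.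

Lemma admissible_eq {x y n} : (forall i, (i < n)%N -> x i = y i) ->
  admissible x n -> admissible y n.
Proof. by move=> xy [p xp]; exists p => i i_n; rewrite -xy// xp. Qed.

Lemma admissible2 x : admissible x 2.
Proof.
case x0 : (x 0%N); case x1: (x 1%N).
- by exists 1%N => -[|[|]]// _; rewrite tm_prefix.
- by exists 2%N => -[|[|]]// _; rewrite tm_prefix.
- by exists 0%N => -[|[|]]// _; rewrite tm_prefix.
- by exists 5%N => -[|[|]]// _; rewrite tm_prefix.
Qed.

(** All six non-constant words of length 3 occur in the first eight digits of [tm]. *)
Lemma not_admissible3 x : ~ admissible x 3 -> x 0%N = x 1%N /\ x 1%N = x 2%N.
Proof.
case x0 : (x 0%N); case x1: (x 1%N); case x2: (x 2%N) => // nadm; exfalso; apply: nadm.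
- by exists 1%N => -[|[|[|]]]// _; rewrite tm_prefix.
- by exists 2%N => -[|[|[|]]]// _; rewrite tm_prefix.
- by exists 4%N => -[|[|[|]]]// _; rewrite tm_prefix.
- by exists 0%N => -[|[|[|]]]// _; rewrite tm_prefix.
- by exists 3%N => -[|[|[|]]]// _; rewrite tm_prefix.
- by exists 5%N => -[|[|[|]]]// _; rewrite tm_prefix.
Qed.

Lemma cube_not_admissible x n :
  x n = x n.+1 -> x n.+1 = x n.+2 -> ~ admissible x n.+3.
Proof.
move=> x01 x12 [p xp]; apply: (@tm_cube_free (p + n)).
by rewrite -!addnS -!xp//; lia.
Qed.

Lemma admissible_subst {x n} : admissible x n -> admissible (tm_subst x) n.*2.
Proof.
move=> [p xp]; exists p.*2 => i ilt; rewrite -tm_substK !tm_subst_eq.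
rewrite oddD odd_double /= halfD odd_double doubleK add0n xp//; lia.
Qed.

Lemma admissible_shift {x n} : admissible x n.+1 -> admissible (Defs.shift x) n.
Proof. by move=> [p xp]; exists p.+1 => i ilt; rewrite addSnnS -xp. Qed.


(** By [dist_to_rank] and [rank_dist_to] this means d(x, K) = 2^-n, in a form on which the
    substitution acts directly. *)
Definition rank x n := admissible x n /\ ~ admissible x n.+1.

Lemma rank_ge2 {x n} : rank x n -> (2 <= n)%N.
Proof.
move=> [_ nxS]; rewrite leqNgt; apply/negP => n2; apply: nxS.
exact: admissible_le (admissible2 x).
Qed.

Lemma rank_ge {x m n} : rank x n -> admissible x m -> (m <= n)%N.
Proof.
move=> [_ nxS] xm; rewrite leqNgt; apply/negP => nm.
by apply: nxS; apply: admissible_le xm.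
Qed.

Lemma rank_inj {x m n} : rank x m -> rank x n -> m = n.
Proof.
by move=> xm xn; apply/eqP; rewrite eqn_leq (rank_ge xn xm.1) (rank_ge xm xn.1).
Qed.

Lemma rank_or x : (forall n, admissible x n) \/ exists n, rank x n.
Proof.
have [adm|/existsNP [n xn]] := pselect (forall n, admissible x n); [by left|right].
elim: n xn => [xn|n IHn xSn]; first by case: xn; exists 0%N.
by have [xn|/IHn//] := pselect (admissible x n); exists n.
Qed.

(** By recognizability, an occurrence of 2n + 1 letters of H x starts at an even position. Reading
    the first letter of each block then yields an occurrence of n + 1 letters of [x]. For n >= 3 the
    five letters compared lie in images of admissible letters. *)
Lemma rank_subst {x n} : (3 <= n)%N -> rank x n -> rank (tm_subst x) n.*2.
Proof.
move=> n3 [xn nxS]; split=> [|[p xp]]; first exact: admissible_subst.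
apply: nxS; have [q xq] := admissible_subst (admissible_le n3 xn).
have p2 : odd p = false.
  have [r xr] := xn; rewrite -(odd_double r).
  apply: tm_recognizable => i i5; rewrite -xp; last lia.
  rewrite -tm_substK !tm_subst_eq oddD odd_double /= halfD odd_double doubleK.
  by rewrite add0n xr//; lia.
exists p./2 => i ilt; rewrite -(tm_subst_double x i) xp; last lia.
by rewrite -(tm_double (_ + i)); congr tm; lia.
Qed.

Lemma rank_shift_subst {x n} : (3 <= n)%N -> rank x n ->
  rank (Defs.shift (tm_subst x)) n.*2.-1.
Proof.
move=> n3 [xn nxS]; split=> [|[p xp]].
  by apply: admissible_shift; rewrite prednK ?double_gt0; [exact: admissible_subst|lia].
apply: nxS; have p2 : odd p.
  have [r xr] := xn; suff -> : odd p = odd r.*2.+1 by rewrite /= odd_double.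
  apply: tm_recognizable => i i5; rewrite -xp; last lia.
  rewrite /Defs.shift -tm_substK !tm_subst_eq xr; last lia.
  rewrite (_ : (r.*2.+1 + i)./2 = r + i.+1./2)%N; last lia.
  by rewrite (_ : odd (r.*2.+1 + i)%N = odd i.+1)//; lia.
(* After the shift, digit 0 of [x] is visible only as the negated second letter of its block; the
   other digits are first letters of theirs. *)
exists p./2 => -[|i] ilt.
  apply: negb_inj; rewrite -(tm_subst_doubleS x 0) -[tm_subst x _]/(Defs.shift (tm_subst x) 0%N).
  rewrite xp; last lia.
  by rewrite -(tm_doubleS (_ + 0)); congr tm; lia.
rewrite -(tm_subst_double x i.+1) doubleS -[tm_subst x _]/(Defs.shift (tm_subst x) _) xp; last lia.
by rewrite -(tm_double (_ + i.+1)); congr tm; lia.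
Qed.

Lemma rank2P x : rank x 2 <-> x 0%N = x 1%N /\ x 1%N = x 2%N.
Proof.
split=> [[_]|[x01 x12]]; first exact: not_admissible3.
by split; [exact: admissible2|exact: cube_not_admissible].
Qed.


Lemma alternating_rank4 x :
  (forall i, (i < 4)%N -> x i = ~~ x i.+1) -> rank x 4.
Proof.
move=> alt; split=> [|[p xp]]; last first.
  apply: (@tm_alternating p) => i i4; rewrite -(xp i); last lia.
  by rewrite -(xp i.+1)//; exact: alt.
have x01 := alt 0%N isT; have x12 := alt 1%N isT; have x23 := alt 2%N isT.
rewrite x23 in x12; rewrite x12 in x01; case x3 : (x 3%N) x23 x12 x01 => x2 x1 x0.
- by exists 10%N => -[|[|[|[|]]]]// _; rewrite tm_prefix.
- by exists 2%N => -[|[|[|[|]]]]// _; rewrite tm_prefix.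
Qed.

(** The image of a cube is alternating of length 6, so at least five alternating letters remain
    after the shift. *)
Lemma rank2_subst {x} : rank x 2 ->
  rank (tm_subst x) 4 /\ rank (Defs.shift (tm_subst x)) 4.
Proof.
move=> /rank2P [x01 x12]; split; apply: alternating_rank4.
  by move=> [|[|[|[|]]]]// _; rewrite !tm_subst_eq /= -?x12 -?x01 ?negbK.
by move=> [|[|[|[|]]]]// _; rewrite /Defs.shift !tm_subst_eq /= -?x12 -?x01 ?negbK.
Qed.

(** Ranks 2, 3 and 4 have explicit witnesses; any larger n is 2k or 2k - 1 with 3 <= k < n. *)
Lemma exists_rank n : (2 <= n)%N -> exists x, rank x n.
Proof.
elim/ltn_ind: n => n IHn n2.
have [->|n2'] := eqVneq n 2%N; first by exists (fun=> false); apply/rank2P.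
have [->|n3] := eqVneq n 3%N.
  exists (fun i => (0 < i)%N); split; last exact: (@cube_not_admissible _ 1).
  by exists 0%N => -[|[|[|]]]// _; rewrite tm_prefix.
have [->|n4] := eqVneq n 4%N.
  exists (tm_subst (fun=> false)).
  by have [] := rank2_subst ((rank2P (fun=> false)).2 (conj erefl erefl)).
have [x xn] : exists x, rank x (uphalf n) by apply: IHn; lia.
have n3' : (3 <= uphalf n)%N by lia.
case: (boolP (odd n)) => nodd.
  have -> : n = (uphalf n).*2.-1 by lia.
  by eexists; exact: rank_shift_subst n3' xn.
have -> : n = (uphalf n).*2 by lia.
by eexists; exact: rank_subst n3' xn.
Qed.

End Words.

(** * Cylinders and the distance to the subshift *)

Section Topology.
Context {R : realType}.
Implicit Types x y : full_shift R.

Lemma exists_exp2_lt (e : R) : 0 < e -> exists n, 2 ^- n < e.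
Proof.
move=> e0; exists (Num.bound e^-1); rewrite -[ltRHS]invrK.
rewrite ltf_pV2 ?posrE ?invr_gt0 ?exprn_gt0//.
apply: lt_trans (archi_boundP _) _; first by rewrite invr_ge0 ltW.
by rewrite -natrX ltr_nat ltn_expl.
Qed.

Lemma nbhs_cylinder x (A : set (full_shift R)) :
  nbhs x A <-> exists n, forall y, (forall i, (i < n)%N -> x i = y i) -> A y.
Proof.
split=> [/nbhs_ballP[e /= e0 xA]|[n xA]].
  have [n ne] := exists_exp2_lt _ e0; exists n => y xy; apply: xA.
  rewrite ballEmdist /=; apply: le_lt_trans ne.
  exact: (shift_dist_le x y n).1.
apply/nbhs_ballP; exists (2 ^- n) => /=; first by rewrite invr_gt0 exprn_gt0.
move=> y; rewrite ballEmdist /= => xy; apply: xA.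
exact: (shift_dist_le x y n).2 (ltW xy).
Qed.

Lemma continuous_cylinder (f : full_shift R -> R) :
  continuous f <-> forall x e, 0 < e ->
    exists n, forall y, (forall i, (i < n)%N -> x i = y i) -> `|f x - f y| <= e.
Proof.
have cvgP x := @cvgrPdist_le _ _ _ (nbhs x) (nbhs_filter x) f (f x).
split=> [fc x e e0|fc x]; first by apply/nbhs_cylinder; exact: (cvgP x).1 (fc x) e e0.
by apply/cvgP => e e0; apply/nbhs_cylinder; exact: fc.
Qed.

Lemma iter_shiftE x n i : iter n Defs.shift x i = x (n + i)%N.
Proof. by elim: n i => // n IHn i; rewrite iterS /Defs.shift IHn addnS. Qed.

Lemma tm_subshiftP x : tm_subshift x <-> forall n, admissible x n.
Proof.
split=> [xK n|xadm A].
  have [] := xK [set y | forall i, (i < n)%N -> x i = y i].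
    by apply/nbhs_cylinder; exists n.
  move=> _ [[p _ <-] xp]; exists p => i i_n.
  by rewrite xp// iter_shiftE.
move=> /nbhs_cylinder[n xA]; have [p xp] := xadm n.
exists (iter p Defs.shift tm); split; first by exists p.
by apply: xA => i i_n; rewrite xp// iter_shiftE.
Qed.

Lemma dist_to_le x n : admissible x n -> dist_to tm_subshift x <= 2 ^- n.
Proof.
move=> [p xp]; apply: (@le_trans _ _ (shift_dist x (iter p Defs.shift tm))).
  apply: ge_inf; first by exists 0 => _ [y _ <-]; exact: mdist_ge0.
  exists (iter p Defs.shift tm) => //; apply: subset_closure; by exists p.
by apply/shift_dist_le => i i_n; rewrite iter_shiftE xp.
Qed.

(** Points of the subshift have admissible prefixes of every length, so none can agree with [x] on n
    + 1 digits. *)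
Lemma dist_to_rank x n : rank x n -> dist_to tm_subshift x = 2 ^- n.
Proof.
move=> [xn nxS]; apply/eqP; rewrite eq_le dist_to_le//=.
apply: lb_le_inf.
  have Ktm : tm_subshift (tm : full_shift R).
    by apply: subset_closure; exists 0%N.
  by exists (mdist x (tm : full_shift R)); exists tm.
move=> _ [y /tm_subshiftP yK <-]; change (2 ^- n <= shift_dist x y).
rewrite /shift_dist; case: pselect => [xy|nxy].
  rewrite lef_pV2 ?posrE ?exprn_gt0// ler_eXn2l ?ltr1n//.
  case: ex_minnP => m _ minm; rewrite leqNgt; apply/negP => nm.
  apply: nxS; apply: (admissible_eq _ (yK n.+1)) => i i_n.
  apply/eqP/negPn/negP => yxi; have := minm i; rewrite eq_sym => /(_ yxi); lia.
exfalso; apply: nxS; apply: (admissible_eq _ (yK n.+1)) => i _.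
by apply/eqP/negPn/negP => yxi; apply: nxy; exists i; rewrite eq_sym.
Qed.

Lemma rank_dist_to x n : dist_to tm_subshift x = 2 ^- n -> rank x n.
Proof.
move=> xn; case: (rank_or x) => [xadm|[m xm]].
  have := dist_to_le _ _ (xadm n.+1); rewrite xn.
  by rewrite lef_pV2 ?posrE ?exprn_gt0// ler_eXn2l ?ltr1n// ltnn.
have two_inj : injective (GRing.exp (2 : R)).
  by apply: ieexprIn; rewrite // gt_eqF ?ltr1n.
have := dist_to_rank _ _ xm; rewrite xn => /invr_inj/two_inj nm.
by rewrite nm.
Qed.

End Topology.

(** * The explicit fixed point of the renormalization operator *)

Section Potential.
Context {R : realType}.
Implicit Types (x y : full_shift R) (V : full_shift R -> R).

(** At rank 2 both image points have rank 4, so invariance forces the value to be twice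
    [profile 4]. *)
Definition profile n : R :=
  if n == 2%N then (ln 4 - ln 3) *+ 2 else ln n%:R - ln n.-1%:R.

(** Both bounds are ln (1 + t) <= t, at t = -1/(m + 1) and at t = 1/m. *)
Lemma ln_succ_bounds {m} : (0 < m)%N ->
  m.+1%:R^-1 <= ln (m.+1%:R : R) - ln (m%:R : R) <= m%:R^-1.
Proof.
move=> m0; have mR : (0 : R) < m%:R by rewrite ltr0n.
have SR : (0 : R) < m.+1%:R by rewrite ltr0n.
have Sm : (m.+1%:R : R) = 1 + m%:R by rewrite -natr1 addrC.
apply/andP; split.
  rewrite -lerN2 opprB -ln_div ?posrE//.
  rewrite (_ : m%:R / m.+1%:R = 1 + - m.+1%:R^-1); last first.
    by rewrite Sm; field; rewrite -Sm gt_eqF.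
  by apply: le_ln1Dx; rewrite ltrN2 invf_lt1// ltr1n.
rewrite -ln_div ?posrE// (_ : m.+1%:R / m%:R = 1 + m%:R^-1); last first.
  by rewrite Sm; field; rewrite gt_eqF.
by apply: le_ln1Dx; apply: lt_trans (_ : 0 < _); rewrite ?invr_gt0// oppr_lt0.
Qed.

Lemma profile_ge_inv n : (3 <= n)%N -> n%:R^-1 <= profile n.
Proof.
case: n => // n n3; rewrite /profile ifF; last lia.
by have /andP[] := @ln_succ_bounds n ltac:(lia).
Qed.

Lemma profile_bounds n : (2 <= n)%N ->
  (2 * n%:R)^-1 <= profile n <= (n%:R - 1)^-1.
Proof.
case: n => // n n2; have [->|nn2] := eqVneq n 1%N.
  (* For rank 2, ln 4 - ln 3 lies in [1/4, 1/3]; its double lies in [1/2, 2/3], inside [1/4, 1]. *)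
  have /andP[] := @ln_succ_bounds 3 isT; rewrite /profile /= mulr2n => l u.
  have -> : 2 * 2 = 4 :> R by ring.
  have -> : 2 - 1 = 1 :> R by ring.
  by rewrite invr1; apply/andP; split; lra.
rewrite -[n.+1%:R]natr1 addrK natr1 /profile ifF; last lia.
have /andP[l ->] := @ln_succ_bounds n ltac:(lia); rewrite andbT.
apply: le_trans l; rewrite lef_pV2 ?posrE ?mulr_gt0 ?ltr0n//.
by rewrite ler_peMl// ler1n.
Qed.

(** The sum telescopes to ln (2n) - ln (2n - 2), where the factor 2 cancels. *)
Lemma profile_renorm n : (3 <= n)%N ->
  profile n.*2.-1 + profile n.*2 = profile n.
Proof.
case: n => // n n3; rewrite /profile !ifF; [|lia..].
rewrite doubleS /= -doubleS -!mul2n !natrM.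
rewrite !lnM ?posrE ?ltr0n//; [ring|lia].
Qed.

Lemma profile_renorm2 : profile 4 + profile 4 = profile 2.
Proof. by rewrite /profile /= mulr2n. Qed.

(* Points of the subshift have no rank: [xget] returns 0, and [profile 0 = 0]. *)
Definition renorm_fix x : R := profile (xget 0%N [set n | rank x n]).

Lemma renorm_fix_rank x n : rank x n -> renorm_fix x = profile n.
Proof. by move=> xn; rewrite /renorm_fix (rank_inj (xgetPex 0%N _) xn)//; exists n. Qed.

Lemma renorm_fix_admissible x : (forall n, admissible x n) -> renorm_fix x = 0.
Proof.
move=> xadm; rewrite /renorm_fix xgetPN ?/profile ?subrr//.
by move=> n [_]; exact.
Qed.

Lemma renorm_fix_ge0 x : 0 <= renorm_fix x.
Proof.
case: (rank_or x) => [/renorm_fix_admissible->//|[n xn]].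
rewrite (renorm_fix_rank _ _ xn).
have /andP[+ _] := profile_bounds n (rank_ge2 xn).
by apply: le_trans; rewrite invr_ge0 mulr_ge0.
Qed.

Lemma renorm_fix_le x n : (2 <= n)%N -> admissible x n ->
  renorm_fix x <= (n%:R - 1)^-1.
Proof.
move=> n2 xn; have n1 : (0 : R) < n%:R - 1 by rewrite subr_gt0 ltr1n.
case: (rank_or x) => [/renorm_fix_admissible->|[m xm]].
  by rewrite invr_ge0 ltW.
have nm := rank_ge xm xn; rewrite (renorm_fix_rank _ _ xm).
have /andP[_ +] := profile_bounds m (rank_ge2 xm).
move/le_trans; apply; rewrite lef_pV2 ?posrE// ?lerD2r ?ler_nat//.
by rewrite subr_gt0 ltr1n; lia.
Qed.

Lemma renorm_renorm_fix : renorm renorm_fix = renorm_fix.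
Proof.
apply/funext => x; rewrite /renorm.
case: (rank_or x) => [xadm|[n xn]].
  have Hadm k : admissible (tm_subst x) k.
    by apply: admissible_le (admissible_subst (xadm k)); lia.
  rewrite !renorm_fix_admissible ?addr0// => k.
  exact: admissible_shift (Hadm k.+1).
rewrite (renorm_fix_rank _ _ xn); have := rank_ge2 xn.
rewrite leq_eqVlt => /predU1P[n2|n3].
  move: xn; rewrite -n2 => /rank2_subst[H1 H2].
  by rewrite (renorm_fix_rank _ _ H1) (renorm_fix_rank _ _ H2) profile_renorm2.
rewrite (renorm_fix_rank _ _ (rank_subst n3 xn)).
by rewrite (renorm_fix_rank _ _ (rank_shift_subst n3 xn)) profile_renorm.
Qed.

End Potential.

(** * Convergence of the iterates and of their means *)

Section Convergence.
Context {R : realType}.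
Implicit Types (x y : full_shift R) (V W : full_shift R -> R).

Lemma exists_inv_lt (e : R) : 0 < e -> exists n, (0 < n)%N /\ n%:R^-1 < e.
Proof.
move=> e0; have e1 : 0 < e^-1 by rewrite invr_gt0.
have be := archi_boundP (ltW e1); exists (Num.bound e^-1).
have b0 : (0 : R) < (Num.bound e^-1)%:R by apply: lt_trans be.
by rewrite -(ltr0n R) b0 -[ltRHS]invrK ltf_pV2 ?posrE.
Qed.

(** The rank is locally constant off the subshift and tends to infinity at its points. *)
Lemma continuous_renorm_fix : continuous (@renorm_fix R).
Proof.
apply/continuous_cylinder => x e e0.
case: (rank_or x) => [xadm|[n xn]]; last first.
  exists n.+1 => y xy; rewrite (renorm_fix_rank _ _ xn) (renorm_fix_rank y n).
    by rewrite subrr normr0 ltW.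
  split; first by apply: (admissible_eq _ xn.1) => i i_n; rewrite xy// ltnW.
  by move=> yn; apply: xn.2; apply: (admissible_eq _ yn) => i i_n; rewrite xy.
have [n [n0 ne]] := exists_inv_lt _ e0; exists n.+1 => y xy.
rewrite renorm_fix_admissible// sub0r normrN ger0_norm ?renorm_fix_ge0//.
apply: le_trans (ltW ne); rewrite -[leRHS](_ : (n.+1%:R - 1)^-1 = _).
  by apply: renorm_fix_le => //; exact: admissible_eq xy (xadm _).
by rewrite -natr1 addrK.
Qed.

Lemma one_over_nP V : one_over_n V -> forall e, 0 < e ->
  exists N, forall n x, (N <= n)%N -> rank x n -> `|V x - n%:R^-1| <= e / n%:R.
Proof.
move=> V1 e e0.
have /V1 : nbhs (0%E : \bar R) (fun u => (u < e%:E)%E).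
  by apply: open_ereal_lt'; rewrite lte_fin.
move=> [N _ NV]; exists (maxn N 2) => n x Nn xn.
have n0 : (0 : R) < n%:R by rewrite ltr0n; lia.
rewrite ler_pdivlMr// mulrC -lee_fin.
apply: le_trans (ltW (NV n _)); last by rewrite /=; lia.
apply: ereal_sup_ubound; exists x => //=; exact: dist_to_rank.
Qed.

Lemma one_over_n_renorm_fix : one_over_n (@renorm_fix R).
Proof.
(* [harmonic (n - 2)] is 1/(n - 1), which bounds n ([profile n] - 1/n) for n >= 3. *)
have lim2 : (harmonic (n - 2)%N)%:E @[n --> \oo] --> (0 : R)%:E.
  apply: cvg_EFin; first by near=> n.
  by rewrite (_ : _ \o _ = [sequence harmonic (n - 2)%N]_n)// cvg_centern; exact: cvg_harmonic.
apply: (squeeze_cvge _ (cvg_cst 0%E) lim2).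
exists 3%N => // n /= n3.
have n0 : (0 : R) < n%:R by rewrite ltr0n; lia.
apply/andP; split.
  (* A point of rank n keeps the supremum from being that of the empty set, -oo. *)
  have [x xn] := @exists_rank R n (ltnW n3).
  apply: le_trans (ereal_sup_ubound _); last first.
    by exists x => //=; exact: dist_to_rank.
  by rewrite lee_fin mulr_ge0// ltW.
apply: ge_ereal_sup => _ [x /rank_dist_to xn <-].
rewrite lee_fin (renorm_fix_rank _ _ xn).
have lo := profile_ge_inv n n3 : _ <= (_ : R).
have /andP[_ up] : _ <= (_ : R) <= _ := profile_bounds n (ltnW n3).
rewrite ger0_norm ?subr_ge0// mulrBr divff ?gt_eqF//.
have n1 : (0 : R) < n%:R - 1 by rewrite subr_gt0 ltr1n; lia.
rewrite /harmonic /= (_ : (n - 2).+1%:R = n%:R - 1 :> R); last first.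
  by apply: (addIr 1); rewrite natr1 subrK; congr (_%:R); lia.
apply: (@le_trans _ _ (n%:R * (n%:R - 1)^-1 - 1)).
  by rewrite lerD2r ler_pM2l.
by rewrite le_eqVlt; apply/orP; left; apply/eqP; field; rewrite gt_eqF.
Unshelve. all: by end_near. Qed.

(* Points of the subshift are limits of points outside of it, whence the value 0. *)
Lemma one_over_n_eq0 V x : continuous V -> one_over_n V ->
  (forall n, admissible x n) -> V x = 0.
Proof.
move=> Vc V1 xadm; apply/eqP/negPn/negP => Vx0.
(* |V x| will be at most |V x - V y| + |V y - 1/n| + 1/n, each term being at most a quarter of |V
   x|. *)
have e0 : 0 < `|V x| / 4 by rewrite divr_gt0// normr_gt0.
have [N NV] := one_over_nP _ V1 _ ltr01.
have [m [m0 me]] := exists_inv_lt _ e0.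
have [k kV] := (continuous_cylinder V).1 Vc x _ e0.
(* The zeros from position [K] on contain a cube, so [y] has a finite rank, which is at least
   [K]. *)
pose K := maxn k (maxn N m); pose y : full_shift R := fun i => (i < K)%N && x i.
have xy i : (i < K)%N -> x i = y i by rewrite /y => ->.
have y0 i : (K <= i)%N -> y i = false by rewrite /y leqNgt => /negPf ->.
have nyK : ~ admissible y K.+3 by apply: cube_not_admissible; rewrite !y0 ?leqW.
case: (rank_or y) => [/(_ K.+3)//|[n yn]].
have Kn : (K <= n)%N := rank_ge yn (admissible_eq xy (xadm K)).
have n0 : (0 : R) < n%:R by rewrite ltr0n; lia.
have := NV n y ltac:(lia) yn; rewrite mul1r => Vy.
have nm : n%:R^-1 <= m%:R^-1 :> R by rewrite lef_pV2 ?posrE ?ltr0n ?ler_nat//; lia.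
have Vxy : `|V x - V y| <= `|V x| / 4.
  by apply: kV => i ik; apply: xy; lia.
have := ler_normD (V x - V y) (V y); rewrite subrK.
have := ler_normD (V y - n%:R^-1) n%:R^-1; rewrite subrK.
have ninv0 : (0 : R) <= n%:R^-1 by rewrite invr_ge0 ltW.
by rewrite (ger0_norm ninv0); lra.
Qed.

(** At large rank n both functions are within e/(2n) of 1/n, and 1/n <= [profile n] makes the error
    e/n relative. On the subshift both vanish. *)
Lemma one_over_n_near V e : continuous V -> one_over_n V -> 0 < e ->
  exists N, forall x, admissible x N ->
    `|V x - renorm_fix x| <= e * renorm_fix x.
Proof.
move=> Vc V1 e0; have e2 : 0 < e / 2 by rewrite divr_gt0.
have [N NV] := one_over_nP _ V1 _ e2; have [m [m0 me]] := exists_inv_lt _ e2.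
exists (maxn N (maxn m.+1 3)) => x xN; case: (rank_or x) => [xadm|[n xn]].
  by rewrite (one_over_n_eq0 V x)// renorm_fix_admissible// subrr normr0 mulr0.
have Nn := rank_ge xn xN; rewrite (renorm_fix_rank _ _ xn).
have n3 : (3 <= n)%N by lia.
have n0 : (0 : R) < n%:R by rewrite ltr0n; lia.
have n1 : (0 : R) < n%:R - 1 by rewrite subr_gt0 ltr1n; lia.
have lo : _ <= (_ : R) := profile_ge_inv n n3.
have /andP[_ up] : _ <= (_ : R) <= _ := profile_bounds n (ltnW n3).
have := NV n x ltac:(lia) xn => Vx.
apply: (@le_trans _ _ (e / n%:R)); last by rewrite ler_pM2l.
have -> : V x - profile n = (V x - n%:R^-1) - (profile n - n%:R^-1) by ring.
apply: le_trans (ler_normB _ _) _; rewrite [`|profile n - _|]ger0_norm ?subr_ge0//.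
have gap : (n%:R - 1)^-1 - n%:R^-1 <= e / 2 / n%:R.
  have -> : (n%:R - 1)^-1 - n%:R^-1 = (n%:R - 1)^-1 / n%:R :> R.
    by field; rewrite !gt_eqF.
  rewrite ler_pM2r ?invr_gt0//; apply: le_trans (ltW me).
  rewrite lef_pV2 ?posrE ?ltr0n// lerBrDr natr1 ler_nat; lia.
have -> : e / n%:R = e / 2 / n%:R + e / 2 / n%:R by field; rewrite gt_eqF.
lra.
Qed.

(* Since [renorm] is a positive operator fixing [renorm_fix], a relative error
   bound passes from the prefixes of length [2m + 1] to those of length [m + 1]. *)
Lemma renorm_near V e m :
  (forall x, admissible x m.*2.+1 -> `|V x - renorm_fix x| <= e * renorm_fix x) ->
  forall x, admissible x m.+1 -> `|renorm V x - renorm_fix x| <= e * renorm_fix x.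
Proof.
move=> Vm x /admissible_subst Hx; rewrite -[in renorm_fix x]renorm_renorm_fix /renorm.
rewrite opprD addrACA mulrDr; apply: le_trans (ler_normD _ _) _.
by apply: lerD; apply: Vm; [exact: admissible_shift|exact: admissible_le Hx].
Qed.

(** Each application of [renorm] lowers the required prefix length from 2^(k+1) + 1 to 2^k + 1, down
    to 2, which every point satisfies. *)
Lemma iter_renorm_near V e k :
  (forall x, admissible x (2 ^ k).+1 -> `|V x - renorm_fix x| <= e * renorm_fix x) ->
  forall x, `|iter k renorm V x - renorm_fix x| <= e * renorm_fix x.
Proof.
elim: k V => [|k IHk] V Vk x; first exact/Vk/admissible2.
by rewrite iterSr; apply: IHk; apply: renorm_near; rewrite -mul2n -expnS.
Qed.

Lemma iter_renorm_cvg V x : continuous V -> one_over_n V ->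
  iter k renorm V x @[k --> \oo] --> renorm_fix x.
Proof.
move=> Vc V1; apply/cvgrPdist_le => e e0.
have [N NV] := one_over_n_near V e Vc V1 e0.
exists N => // k /= Nk; rewrite distrC.
apply: (@le_trans _ _ (e * renorm_fix x)).
  apply: iter_renorm_near => y yk; apply: NV; apply: admissible_le yk.
  by apply: leq_trans Nk _; apply: ltnW; apply: ltnW; rewrite ltnS ltn_expl.
(* [renorm_fix] is at most 1 everywhere, so the relative error e is also an absolute one. *)
apply: ler_piMr; first exact: ltW.
have := renorm_fix_le x 2 isT (admissible2 x).
by rewrite (_ : 2 - 1 = 1) ?invr1//; ring.
Qed.

Lemma cesaro_renorm V : continuous V -> one_over_n V ->
  is_cesaro_limit V renorm_fix.
Proof.
(* The index shift matches [cesaro], whose n-th mean has n + 1 terms. *)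
move=> Vc V1 x; rewrite -cvg_shiftS.
exact: cesaro (iter_renorm_cvg V x Vc V1).
Qed.

End Convergence.

Theorem theorem2 (R : realType) :
  exists Vt : full_shift R -> R,
    unique (fun W : full_shift R -> R =>
      forall V : full_shift R -> R,
        continuous V -> one_over_n V -> is_cesaro_limit V W) Vt /\
    renorm Vt = Vt /\
    continuous Vt /\
    (forall x : full_shift R, tm_subshift x -> Vt x = 0) /\
    (forall x : full_shift R, ~ tm_subshift x -> 0 < Vt x) /\
    (forall (n : nat) (x : full_shift R),
      dist_to tm_subshift x = 2 ^- n ->
      (2 * n%:R)^-1 <= Vt x <= (n%:R - 1)^-1).
Proof.
have bounds n (x : full_shift R) : rank x n ->
    (2 * n%:R)^-1 <= renorm_fix x <= (n%:R - 1)^-1.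
  by move=> xn; rewrite (renorm_fix_rank _ _ xn); exact: profile_bounds (rank_ge2 xn).
exists renorm_fix; split; last split; last split; last split; last split.
- split=> [V|W /(_ renorm_fix continuous_renorm_fix one_over_n_renorm_fix) cW].
    exact: cesaro_renorm.
  apply/funext => x; apply: cvg_unique (cW x); first exact: Rhausdorff.
  exact: cesaro_renorm continuous_renorm_fix one_over_n_renorm_fix x.
- exact: renorm_renorm_fix.
- exact: continuous_renorm_fix.
- by move=> x /tm_subshiftP/renorm_fix_admissible.
- move=> x xK; case: (rank_or x) => [/tm_subshiftP//|[n xn]].
  have /andP[+ _] := bounds n x xn; apply: lt_le_trans.
  by rewrite invr_gt0 mulr_gt0// ltr0n (ltnW (rank_ge2 xn)).
- by move=> n x /rank_dist_to; exact: bounds.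
Qed.
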